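(* Let $R$ be a $2$-torsion free $\sigma$-prime ring, where $\sigma$ is an involution of $R$, and let $U$ be a $\sigma$-Lie ideal of $R$ with $U\not\subset Z(R)$. If $a,b\in R$ are such that $aUb=\sigma(a)Ub=0$ (that is, $aub=0$ and $\sigma(a)ub=0$ for all $u\in U$), then $a=0$ or $b=0$.
   Context: Rings are associative and not assumed to have an identity element. $Z(R)$ denotes the center of $R$, and $[x,y]=xy-yx$. $R$ is $2$-torsion free if $2x=0$ with $x\in R$ implies $x=0$. An involution $\sigma$ of $R$ is an additive map $\sigma:R\to R$ with $\sigma(xy)=\sigma(y)\sigma(x)$ and $\sigma(\sigma(x))=x$ for all $x,y\in R$. A ring $R$ with involution $\sigma$ is $\sigma$-prime if, for all $a,b\in R$, $aRb=aR\sigma(b)=0$ implies $a=0$ or $b=0$. A Lie ideal of $R$ is an additive subgroup $U$ of $R$ such that $[u,r]\in U$ for all $u\in U$, $r\in R$. A $\sigma$-Lie ideal is a Lie ideal $U$ with $\sigma(U)=U$. *)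

(* Defs.v *)
From HB Require Import structures.
From mathcomp Require Import all_boot all_algebra.
From mathcomp Require Import classical_sets.

Set Implicit Arguments.
Unset Strict Implicit.
Unset Printing Implicit Defensive.

Import GRing.Theory.

Local Open Scope classical_set_scope.
Local Open Scope ring_scope.

(* The ring structures of ssralg all have a multiplicative identity.  Rings
   without one are obtained here by joining an additive group and a
   multiplicative semigroup, so the multiplication is monoid.mul,
   written **, and not GRing.mul. *)
HB.mixin Record Zmodule_Semigroup_isRng R
    of GRing.Zmodule R & Semigroup R := {
  rng_mulDl : left_distributive (@monoid.mul R) +%R;
  rng_mulDr : right_distributive (@monoid.mul R) +%R
}.

#[short(type="rngType")]
HB.structure Definition Rng :=
  { R of GRing.Zmodule R & Semigroup R & Zmodule_Semigroup_isRng R }.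

Notation "x ** y" := (monoid.mul x y)
  (at level 40, left associativity) : ring_scope.

Section RngDefs.

Variable R : rngType.
Implicit Types (x y a b r : R) (sigma : R -> R) (U : set R).

Definition lie x y : R := x ** y - y ** x.

Definition center : set R := [set z | forall x, z ** x = x ** z].

Definition two_torsion_free : Prop := forall x, x *+ 2 = 0 -> x = 0.

Definition ring_involution sigma : Prop :=
  [/\ {morph sigma : x y / x + y},
      forall x y, sigma (x ** y) = sigma y ** sigma x
    & involutive sigma].

Definition sigma_prime sigma : Prop :=
  forall a b,
    (forall r, a ** r ** b = 0) -> (forall r, a ** r ** sigma b = 0) ->
    a = 0 \/ b = 0.

Definition additive_subgroup U : Prop :=
  U 0 /\ (forall x y, U x -> U y -> U (x - y)).

Definition lie_ideal U : Prop :=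
  additive_subgroup U /\ (forall u r, U u -> U (lie u r)).

Definition sigma_lie_ideal sigma U : Prop :=
  lie_ideal U /\ sigma @` U = U.

End RngDefs.

Arguments center : clear implicits.
Arguments two_torsion_free : clear implicits.

(* Main.v *)
Require Import Defs.
From mathcomp Require Import all_boot all_algebra.
From mathcomp Require Import boolp classical_sets.

(* A sigma-prime ring is semiprime, so a noncentral Lie ideal U contains some
   c = [u, v] != 0, and Herstein's argument gives [RcR, R] `<=` U.  Hence
   a[m, t]b = 0 for m in RcR.  Taking m = u b s c r with u in U kills a m t b,
   leaving aR(u b s c r b) = 0; the same holds for sigma a.  If a != 0, then
   U(b s c r b) = 0, which forces bRcRb = 0, then bRc = 0, and finally b = 0. *)

Import GRing.Theory.

Local Open Scope classical_set_scope.
Local Open Scope ring_scope.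

Section RngTheory.

Context {R : rngType}.
Implicit Types (x y z a b : R) (U : set R).

Lemma rng_mul0r x : 0 ** x = 0 :> R.
Proof. by apply: (addrI (0 ** x)); rewrite -rng_mulDl !addr0. Qed.

Lemma rng_mulr0 x : x ** 0 = 0 :> R.
Proof. by apply: (addrI (x ** 0)); rewrite -rng_mulDr !addr0. Qed.

Lemma rng_mulNr x y : (- x) ** y = - (x ** y).
Proof. by apply: (addrI (x ** y)); rewrite -rng_mulDl !subrr rng_mul0r. Qed.

Lemma rng_mulrN x y : x ** (- y) = - (x ** y).
Proof. by apply: (addrI (x ** y)); rewrite -rng_mulDr !subrr rng_mulr0. Qed.

Lemma rng_mulBl x y z : (x - y) ** z = x ** z - y ** z.
Proof. by rewrite rng_mulDl rng_mulNr. Qed.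

Lemma rng_mulBr x y z : z ** (x - y) = z ** x - z ** y.
Proof. by rewrite rng_mulDr rng_mulrN. Qed.

Lemma lieDr x y z : lie x (y + z) = lie x y + lie x z.
Proof. by rewrite /lie rng_mulDr rng_mulDl opprD addrACA. Qed.

Lemma lieBl x y z : lie (x - y) z = lie x z - lie y z.
Proof. by rewrite /lie rng_mulBl rng_mulBr !opprD addrACA. Qed.

Lemma lieMr x y z : lie x (y ** z) = lie x y ** z + y ** lie x z.
Proof. by rewrite /lie rng_mulBl rng_mulBr !mulgA addrA subrK. Qed.

Lemma lieMl x y z : lie (x ** y) z = lie x (y ** z) + lie y (z ** x).
Proof. by rewrite /lie !mulgA addrA subrK. Qed.

Definition semiprime_rng := forall a, (forall r, a ** r ** a = 0) -> a = 0.

(** Put [d = lie x]. Leibniz applied to [d (d (p ** q)) = 0] leaves [2 d(p) d(q) = 0]; taking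
    [p = y], [q = z ** y] then gives [d(y) z d(y) = 0]. *)
Lemma lie_square_zero_central x : two_torsion_free R -> semiprime_rng ->
  (forall y, lie x (lie x y) = 0) -> center R x.
Proof.
move=> tf sp dd y; apply/eqP; rewrite -subr_eq0; apply/eqP; apply: (sp) => z.
have dd0 p q : lie x p ** lie x q = 0.
  apply: tf; have := dd (p ** q).
  by rewrite lieMr lieDr !lieMr !dd rng_mul0r rng_mulr0 add0r addr0 mulr2n.
have := dd0 y (z ** y).
by rewrite lieMr rng_mulDr !mulgA dd0 rng_mul0r add0r.
Qed.

(** Herstein's auxiliary set [T(U)]: for a Lie ideal [U] it contains [U] and is closed under
    differences and products. *)
Definition lie_multiplier U : set R := [set x | forall r, U (lie x r)].

Section LieIdeal.

Variables (U : set R) (U_lie : lie_ideal U).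

Lemma lie_idealB x y : U x -> U y -> U (x - y).
Proof. by case: U_lie => [[_ UB] _]; apply: UB. Qed.

Lemma lie_idealD x y : U x -> U y -> U (x + y).
Proof.
case: U_lie => [[U0 UB] _] Ux Uy; rewrite -[y]opprK; apply: (UB) => //.
by rewrite -[- y]add0r; apply: UB.
Qed.

Lemma lie_ideal_multiplier x : U x -> lie_multiplier U x.
Proof. by case: U_lie => [_ UL] Ux r; apply: UL. Qed.

Lemma lie_multiplierB x y :
  lie_multiplier U x -> lie_multiplier U y -> lie_multiplier U (x - y).
Proof. by move=> Tx Ty r; rewrite lieBl; apply: lie_idealB. Qed.

Lemma lie_multiplierM x y :
  lie_multiplier U x -> lie_multiplier U y -> lie_multiplier U (x ** y).
Proof. by move=> Tx Ty r; rewrite lieMl; apply: lie_idealD. Qed.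

(** With [c = lie u v], Leibniz writes [c p] as [[u, v p] - v [u, p]], built from elements of [U]
    inside [T(U)]. A left factor is then absorbed by [s c r = c r s - [c r, s]]. *)
Lemma lie_multiplier_ideal u v s r :
  U u -> U v -> lie_multiplier U (s ** lie u v ** r).
Proof.
move=> Uu Uv.
have Tr p : lie_multiplier U (lie u v ** p).
  have -> : lie u v ** p = lie u (v ** p) - v ** lie u p.
    by rewrite lieMr addrK.
  apply: lie_multiplierB.
    by apply: lie_ideal_multiplier; apply: lie_ideal_multiplier.
  apply: lie_multiplierM; first exact: lie_ideal_multiplier.
  by apply: lie_ideal_multiplier; apply: lie_ideal_multiplier.
have -> : s ** lie u v ** r = lie u v ** (r ** s) - lie (lie u v ** r) s.
  by rewrite [lie (_ ** r) s]/lie opprB !mulgA addrC subrK.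
by apply: lie_multiplierB => //; apply: lie_ideal_multiplier; apply: Tr.
Qed.

(** In [[u, r] q = u r q - r u q] both the left side and [r u q] vanish. *)
Lemma lie_ideal_annihilator q : (forall u, U u -> u ** q = 0) ->
  forall u r, U u -> u ** r ** q = 0.
Proof.
move=> Uq u r Uu; have := Uq _ (lie_ideal_multiplier _ Uu r).
by rewrite /lie rng_mulBl -(mulgA r) (Uq u Uu) rng_mulr0 subr0.
Qed.

Lemma commutative_lie_ideal_central :
  two_torsion_free R -> semiprime_rng ->
  (forall u v, U u -> U v -> lie u v = 0) -> U `<=` center R.
Proof.
move=> tf sp UU0 u Uu; apply: lie_square_zero_central => // y.
by apply: UU0 => //; apply: lie_ideal_multiplier.
Qed.

End LieIdeal.

Section SigmaPrime.

Variables (sigma : R -> R).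
Hypotheses (sigma_inv : ring_involution sigma) (R_prime : sigma_prime sigma).

Lemma involution0 : sigma 0 = 0.
Proof.
by case: sigma_inv => sD _ _; apply: (addrI (sigma 0)); rewrite -sD !addr0.
Qed.

Lemma involutionB x y : sigma (x - y) = sigma x - sigma y.
Proof.
by case: sigma_inv => sD _ _; apply: (addIr (sigma y)); rewrite -sD !subrK.
Qed.

Lemma involution_lie x y : sigma (lie x y) = lie (sigma y) (sigma x).
Proof. by case: sigma_inv => _ sM _; rewrite /lie involutionB !sM. Qed.

(** Applying [sigma] reverses products, which moves the twist in sigma-primeness to the left factor,
    where the hypotheses on [a] have it. *)
Lemma sigma_primeC a b :
  (forall r, a ** r ** b = 0) -> (forall r, sigma a ** r ** b = 0) ->
  a = 0 \/ b = 0.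
Proof.
case: sigma_inv => _ sM sK ab sab.
have flip p : (forall r, p ** r ** b = 0) ->
    forall r, sigma b ** r ** sigma p = 0.
  move=> pb r; have := congr1 sigma (pb (sigma r)).
  by rewrite !sM sK involution0 mulgA.
case: (R_prime (sigma b) a).
- by move=> r; rewrite -[a]sK; apply: flip.
- exact: flip.
- by move=> sb0; right; rewrite -[b]sK sb0 involution0.
- by left.
Qed.

(** If [aRa = 0], then [a] kills [R (a r sigma(a))] and also its twist, since [sigma(a r sigma(a)) =
    a sigma(r) sigma(a)]. So [aR sigma(a) = 0], and sigma-primeness applies again. *)
Lemma sigma_prime_semiprime : semiprime_rng.
Proof.
case: sigma_inv => _ sM sK a aa.
have [//|a0] := pselect (a = 0).
suff asa r : a ** r ** sigma a = 0 by case: (R_prime a a).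
case: (R_prime a (a ** r ** sigma a)) => // p.
  by rewrite !mulgA aa !rng_mul0r.
by rewrite !sM sK !mulgA aa !rng_mul0r.
Qed.

End SigmaPrime.

End RngTheory.

Theorem lemma4 (R : rngType) (sigma : R -> R) (U : set R) (a b : R)
    (R_2tf : two_torsion_free R)
    (sigma_inv : ring_involution sigma)
    (R_prime : sigma_prime sigma)
    (U_lie : sigma_lie_ideal sigma U)
    (U_noncentral : ~ (U `<=` center R))
    (aUb : forall u, U u -> a ** u ** b = 0)
    (saUb : forall u, U u -> sigma a ** u ** b = 0) :
  a = 0 \/ b = 0.
Proof.
case: U_lie => UL Us.
have Usigma u : U u -> U (sigma u) by move=> Uu; rewrite -Us; exists u.
have sp := sigma_prime_semiprime _ sigma_inv R_prime.
have [->|a0] := pselect (a = 0); [by left | right].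
have [//|b0] := pselect (b = 0).
(* With [a] and [b] nonzero, a contradiction follows once all commutators of elements of [U]
   vanish. *)
case: (U_noncentral); apply: commutative_lie_ideal_central => // v w Uv Uw.
(* A general [p] serves both [a] and [sigma a]. *)
have key p (pUb : forall u, U u -> p ** u ** b = 0) x y s r t u :
    U x -> U y -> U u -> p ** t ** (u ** (b ** s ** lie x y ** r ** b)) = 0.
  move=> Ux Uy Uu.
  have := pUb _ (lie_multiplier_ideal _ UL x y (u ** b ** s) r Ux Uy t).
  rewrite [lie (_ ** r) t]/lie rng_mulBr rng_mulBl !mulgA pUb // !rng_mul0r.
  by rewrite sub0r => /eqP; rewrite oppr_eq0 => /eqP.
have bcb x y s r : U x -> U y -> b ** s ** lie x y ** r ** b = 0.
  move=> Ux Uy; set q := _ ** b.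
  have Uq u : U u -> u ** q = 0.
    move=> Uu.
    by case: (sigma_primeC _ sigma_inv R_prime a (u ** q)) => // t; apply: key.
  have URq := lie_ideal_annihilator _ UL q Uq.
  have [//|q0] := pselect (q = 0).
  (* Since [U] is sigma-stable, [u R q = sigma(u) R q = 0]; so [q != 0] would make [U] zero, hence
     central. *)
  case: U_noncentral => u Uu; suff -> : u = 0.
    by move=> z; rewrite rng_mul0r rng_mulr0.
  by case: (sigma_primeC _ sigma_inv R_prime u q) => // r'; apply: URq => //;
    apply: Usigma.
have bc x y s : U x -> U y -> b ** s ** lie x y = 0.
  by move=> Ux Uy; apply: sp => r; rewrite !mulgA bcb // !rng_mul0r.
(* [sigma] sends [[v, w]] to [[sigma w, sigma v]], again a commutator from [U], so [bc] covers both
   conditions. *)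
case: (R_prime b (lie v w)) => // r; first exact: bc.
by rewrite involution_lie //; apply: bc; apply: Usigma.
Qed.
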